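(* Let $n$ and $r$ be nonnegative integers. Then \[ \sum_{k=0}^{n}B_{k}(x)B_{n-k}(x)=\frac{1}{2^{r}}\sum_{k=0}^{n}\sum_{l=k}^{n}\sum_{j=0}^{r}\binom{r}{j}\binom{n+1}{k}B_{l-k}(j)\,B_{n-l}(j)\,E_{k}^{(r)}(x). \]
   Context: The Bernoulli polynomials $B_n(x)$ are defined by $\frac{t}{e^{t}-1}e^{xt}=\sum_{n\ge0}B_{n}(x)\frac{t^{n}}{n!}$. For a nonnegative integer $r$, the Euler polynomials of order $r$ are defined by $\left(\frac{2}{e^{t}+1}\right)^{r}e^{xt}=\sum_{n\ge0}E_{n}^{(r)}(x)\frac{t^{n}}{n!}$. *)

(* Defs.v *)
From mathcomp Require Import all_boot all_order all_algebra.

Set Implicit Arguments.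
Unset Strict Implicit.
Unset Printing Implicit Defensive.

Import GRing.Theory Num.Theory.
Local Open Scope ring_scope.

(* Formal power series in t over A, given by their coefficient sequences. *)
Definition fps (A : Type) := nat -> A.

Section FormalPowerSeries.
Variable A : comUnitRingType.
Implicit Types f g : fps A.

Definition fps_const (a : A) : fps A := fun n => if n is 0%N then a else 0.

Definition fps_add f g : fps A := fun n => f n + g n.

Definition fps_sub f g : fps A := fun n => f n - g n.

Definition fps_mul f g : fps A := fun n => \sum_(i < n.+1) f i * g (n - i)%N.

Definition fps_pow f (r : nat) : fps A := iter r (fps_mul f) (fps_const 1).

(* The quotient f / t, for f with zero constant term. *)
Definition fps_divt f : fps A := fun n => f n.+1.

(* The first m coefficients g_0, ..., g_(m-1) of the inverse g of f, from
   f_0 g_m = [m = 0] - \sum_(i < m) g_i f_(m-i). *)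
Fixpoint fps_inv_prefix f (m : nat) : seq A :=
  if m is m'.+1 then
    let s := fps_inv_prefix f m' in
    rcons s ((f 0%N)^-1 * ((m' == 0)%:R - \sum_(i < m') s`_i * f (m' - i)%N))
  else [::].

(* The multiplicative inverse of f, meaningful when f_0 is a unit: fps_mulVf. *)
Definition fps_inv f : fps A := fun n => (fps_inv_prefix f n.+1)`_n.

Lemma size_fps_inv_prefix f m : size (fps_inv_prefix f m) = m.
Proof. by elim: m => //= m IHm; rewrite size_rcons IHm. Qed.

Lemma nth_fps_inv_prefix f m i :
  (i < m)%N -> (fps_inv_prefix f m)`_i = fps_inv f i.
Proof.
elim: m => // m IHm; rewrite ltnS leq_eqVlt => /orP[/eqP -> //|lt_im].
by rewrite /= nth_rcons size_fps_inv_prefix lt_im IHm.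
Qed.

Lemma fps_mulVf f :
  f 0%N \is a GRing.unit -> fps_mul (fps_inv f) f =1 fps_const 1.
Proof.
move=> Uf0 n; rewrite /fps_mul big_ord_recr /= subnn.
rewrite {2}/fps_inv /= nth_rcons size_fps_inv_prefix ltnn eqxx.
rewrite mulrC mulVKr //.
under eq_bigr => i _ do rewrite -(nth_fps_inv_prefix f (ltn_ord i)).
by rewrite addrC subrK; case: n.
Qed.

End FormalPowerSeries.

Section SpecialPolynomials.
Variable R : numFieldType.

(* e^(p t), for p a polynomial in x. *)
Definition fps_exp (p : {poly R}) : fps {poly R} :=
  fun n => (n`!%:R^-1 : R) *: p ^+ n.

(* t / (e^t - 1) * e^(x t), with t / (e^t - 1) = ((e^t - 1) / t)^-1. *)
Definition bernoulli_gf : fps {poly R} :=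
  fps_mul (fps_inv (fps_divt (fps_sub (fps_exp 1) (fps_const 1))))
          (fps_exp 'X).

Definition bernoulli (n : nat) : {poly R} := n`!%:R *: bernoulli_gf n.

(* (2 / (e^t + 1))^r * e^(x t) *)
Definition euler_gf (r : nat) : fps {poly R} :=
  fps_mul
    (fps_pow (fps_mul (fps_const 2)
                      (fps_inv (fps_add (fps_exp 1) (fps_const 1)))) r)
    (fps_exp 'X).

Definition euler (r n : nat) : {poly R} := n`!%:R *: euler_gf r n.

Lemma bernoulli_denom0 :
  fps_sub (fps_exp 1) (fps_const 1) 0%N = 0 /\
  fps_divt (fps_sub (fps_exp 1) (fps_const 1)) 0%N \is a GRing.unit.
Proof.
by rewrite /fps_divt /fps_sub /fps_exp /= fact0 !expr1n !invr1 !scale1r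
   subr0 subrr unitr1.
Qed.

Lemma euler_denom0 :
  fps_add (fps_exp 1) (fps_const 1) 0%N \is a GRing.unit.
Proof.
rewrite /fps_add /fps_exp /= fact0 expr0 invr1 scale1r -polyC1 -polyCD.
by rewrite poly_unitE coefC size_polyC /= (pnatr_eq0 R 2) unitfE (pnatr_eq0 R 2).
Qed.

End SpecialPolynomials.

Arguments bernoulli R n : clear implicits.
Arguments euler R r n : clear implicits.

(* Main.v *)
Require Import Defs.
From mathcomp Require Import all_boot all_order all_algebra.
From mathcomp Require Import ring.

Import GRing.Theory Num.Theory.
Local Open Scope ring_scope.

(** Write S_n for the left-hand side.  Since B_n' = n B_(n-1), one has
    S_n' = (n+1) S_(n-1), so the polynomials q_n = S_n / (n+1)! satisfy
    q_n' = q_(n-1); hence sum_n q_n(x) t^n = c(t) e^(xt) with c independent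
    of x.  Multiplying c(t) e^(xt) by
    1 = 2^-r (e^t + 1)^r (2 / (e^t + 1))^r = 2^-r sum_j C(r,j) e^(jt) (2 / (e^t + 1))^r
    and comparing coefficients of t^n gives the identity, because
    c(t) e^(jt) generates the values q_n(j). *)

(** * Commutative ring laws for formal power series *)

Section FpsAlgebra.
Variable A : comUnitRingType.
Implicit Types f g h : fps A.

Lemma eq_fps_mul f f' g g' :
  f =1 f' -> g =1 g' -> fps_mul f g =1 fps_mul f' g'.
Proof. by move=> ff' gg' n; apply: eq_bigr => i _; rewrite ff' gg'. Qed.

(* Reduces the ring laws for [fps_mul] to those of [{poly A}] by truncation. *)
Lemma fps_mul_coefM f g (p q : {poly A}) n :
  (forall i, (i <= n)%N -> p`_i = f i) -> (forall i, (i <= n)%N -> q`_i = g i) ->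
  fps_mul f g n = (p * q)`_n.
Proof.
move=> pf qg; rewrite coefM; apply: eq_bigr => i _.
by rewrite pf ?qg ?leq_subr // -ltnS.
Qed.

Lemma coef_truncation f n i : (i <= n)%N -> (\poly_(j < n.+1) f j)`_i = f i.
Proof. by move=> le_in; rewrite coef_poly ltnS le_in. Qed.

Lemma fps_mulC f g : fps_mul f g =1 fps_mul g f.
Proof.
move=> n; rewrite !(fps_mul_coefM _ _ _ _ _ (coef_truncation _ n)
  (coef_truncation _ n)).
by rewrite mulrC.
Qed.

Lemma fps_mulA f g h : fps_mul f (fps_mul g h) =1 fps_mul (fps_mul f g) h.
Proof.
move=> n.
(* A product of truncations agrees with the series product only up to degree [n], which is all that
   coefficient [n] of a triple product sees. *)
have trM f1 f2 i : (i <= n)%N ->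
    ((\poly_(j < n.+1) f1 j) * (\poly_(j < n.+1) f2 j))`_i = fps_mul f1 f2 i.
  move=> le_in; symmetry.
  by apply: fps_mul_coefM => j le_ji; apply: coef_truncation;
     apply: leq_trans le_in.
rewrite (fps_mul_coefM _ _ _ _ _ (coef_truncation f n) (trM g h)).
by rewrite (fps_mul_coefM _ _ _ _ _ (trM f g) (coef_truncation h n)) mulrA.
Qed.

Lemma fps_mul_const f a n : fps_mul f (fps_const a) n = f n * a.
Proof.
rewrite /fps_mul big_ord_recr /= subnn big1 ?add0r // => i _.
have: (0 < n - i)%N by rewrite subn_gt0.
by case: (n - i)%N => // m _; rewrite /= mulr0.
Qed.

Lemma fps_mulDr f g h n :
  fps_mul f (fps_add g h) n = fps_mul f g n + fps_mul f h n.
Proof. by rewrite -big_split; apply: eq_bigr => i _; rewrite mulrDr. Qed.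

End FpsAlgebra.

Arguments eq_fps_mul {A f f' g g'}.

(** Pascal's rule, with one of the two resulting sums shifted by one. It drives the induction on [r]
    in [euler_gf_binomial]. *)
Lemma sum_binS (V : nmodType) (F : nat -> V) r :
  \sum_(0 <= j < r.+2) F j *+ 'C(r.+1, j) =
  \sum_(0 <= j < r.+1) (F j + F j.+1) *+ 'C(r, j).
Proof.
rewrite big_nat_recl //= bin0.
under eq_bigr => j _ do rewrite binS mulrnDr.
rewrite big_split /= big_nat_recr //= bin_small // mulr0n addr0 addrA.
under [RHS]eq_bigr => j _ do rewrite mulrnDl.
rewrite big_split /=; congr (_ + _).
by rewrite [RHS]big_nat_recl // bin0.
Qed.

(** * Appell sequences: differentiation in x and generating functions *)

Section AppellSequences.
Variable R : numFieldType.
Implicit Types (f g q : fps {poly R}) (p : {poly R}).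

Lemma natf_fact_neq0 n : n`!%:R != 0 :> R.
Proof. by rewrite pnatr_eq0 -lt0n fact_gt0. Qed.

(** The binomial theorem divided by [n!]. *)
Lemma fps_expD p p' :
  fps_exp (p + p') =1 fps_mul (fps_exp p) (fps_exp p').
Proof.
move=> n; rewrite fps_mulC /fps_exp /fps_mul exprDn scaler_sumr.
apply: eq_bigr => i _; rewrite -scalerAl -scalerAr scalerA mulrC.
rewrite -scaler_nat scalerA; congr (_ *: _).
have le_in : (i <= n)%N by rewrite -ltnS.
rewrite -(bin_fact le_in) !natrM !invfM.
rewrite [_%:R^-1 * _]mulrC -mulrA mulVf ?mulr1 //.
by rewrite pnatr_eq0 -lt0n bin_gt0.
Qed.

Lemma deriv_fps_exp n : (@fps_exp R 'X n.+1)^`() = fps_exp 'X n.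
Proof.
rewrite /fps_exp linearZ /= derivXn -scaler_nat scalerA factS natrM invfM.
by rewrite mulrAC mulVf ?mul1r // pnatr_eq0.
Qed.

Lemma deriv_fps_mul f g n :
  (fps_mul f g n)^`() =
  fps_mul (fun i => (f i)^`()) g n + fps_mul f (fun i => (g i)^`()) n.
Proof. by rewrite raddf_sum -big_split; apply: eq_bigr => i _; rewrite /= derivM. Qed.

Lemma fps_exp0 p : fps_exp p 0%N = 1.
Proof. by rewrite /fps_exp invr1 scale1r. Qed.

(** When [f] is independent of x, d/dx only multiplies e^(xt) by t, which shifts the coefficients by
    one. *)
Lemma deriv_fps_mul_exp f n :
  (forall i, (f i)^`() = 0) ->
  (fps_mul f (fps_exp 'X) n)^`() =
  if n is m.+1 then fps_mul f (fps_exp 'X) m else 0.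
Proof.
move=> Df; rewrite deriv_fps_mul [X in X + _]big1 ?add0r => [|i _]; last first.
  by rewrite Df mul0r.
rewrite /fps_mul big_ord_recr /= subnn fps_exp0 -polyC1 derivC mulr0 addr0.
case: n => [|n]; first by rewrite big_ord0.
by apply: eq_bigr => -[i /= le_in] _; rewrite (subSn (le_in : i <= n)%N) deriv_fps_exp.
Qed.

(** Differentiating f^-1 f = 1 gives (f^-1)' f = 0, and multiplying by f^-1 removes the factor f. *)
Lemma deriv_fps_inv f :
  f 0%N \is a GRing.unit -> (forall n, (f n)^`() = 0) ->
  forall n, (fps_inv f n)^`() = 0.
Proof.
move=> Uf0 Df n; set D := fun i => (fps_inv f i)^`().
have Dinv_f : fps_mul D f =1 fun=> 0.
  move=> m; have := deriv_fps_mul (fps_inv f) f m.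
  rewrite fps_mulVf // [X in _ + X]big1 => [|i _]; last by rewrite Df mulr0.
  by rewrite addr0 => <-; case: m => [|m]; rewrite ?derivC ?deriv0 // -polyC1 derivC.
have fV : fps_mul f (fps_inv f) =1 fps_const 1.
  by move=> m; rewrite fps_mulC fps_mulVf.
rewrite -[LHS]/(D n) -[D n]mulr1 -fps_mul_const.
rewrite -(eq_fps_mul (frefl D) fV) fps_mulA.
by rewrite /fps_mul big1 // => i _; rewrite [X in X * _]Dinv_f mul0r.
Qed.

Lemma deriv0_polyC p : p^`() = 0 -> p = p.[0]%:P.
Proof.
move=> Dp; apply/polyP => -[|i]; rewrite coefC /= ?horner_coef0 //.
have /eqP := congr1 (fun q : {poly R} => q`_i) Dp.
by rewrite coef_deriv coef0 mulrn_eq0 /= => /eqP.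
Qed.

(** Induction on the index: both sides have the same derivative, by the previous case, and the same
    value at 0, so their difference is a constant equal to 0. *)
Lemma appell_gf q :
  (forall n, (q n)^`() = if n is m.+1 then q m else 0) ->
  q =1 fps_mul (fun i => (q i).[0]%:P) (fps_exp 'X).
Proof.
move=> Dq; set c := fun i => _.
have Dc i : (c i)^`() = 0 by rewrite derivC.
(* At x = 0 the series e^(xt) becomes 1, so only the last term of the convolution survives. *)
have at0 n : (fps_mul c (fps_exp 'X) n).[0] = (q n).[0].
  rewrite /fps_mul big_ord_recr /= subnn fps_exp0 mulr1 hornerD hornerC.
  rewrite horner_sum big1 ?add0r // => i _.
  have: (0 < n - i)%N by rewrite subn_gt0.
  case: (n - i)%N => // m _.
  by rewrite /fps_exp hornerM hornerZ hornerXn expr0n !mulr0.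
elim=> [|n IHn]; apply/eqP; rewrite -subr_eq0.
  rewrite (@deriv0_polyC (_ - _)) ?hornerD ?hornerN ?at0 ?subrr //.
  by rewrite derivB deriv_fps_mul_exp // Dq subrr.
rewrite (@deriv0_polyC (_ - _)) ?hornerD ?hornerN ?at0 ?subrr //.
by rewrite derivB deriv_fps_mul_exp // Dq IHn subrr.
Qed.

(** Setting x = a turns e^(xt) into e^(at); values are kept as constant polynomials so that all
    series share one coefficient ring. *)
Lemma appell_horner q (c : nat -> R) (a : R) n :
  q =1 fps_mul (fun i => (c i)%:P) (fps_exp 'X) ->
  (q n).[a]%:P = fps_mul (fun i => (c i)%:P) (fps_exp a%:P) n.
Proof.
move=> ->; rewrite /fps_mul horner_sum rmorph_sum; apply: eq_bigr => i _ /=.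
rewrite hornerM hornerC polyCM /fps_exp hornerZ hornerXn.
by rewrite -mul_polyC polyCM rmorphXn.
Qed.

End AppellSequences.

(** * The Bernoulli convolution as an Appell sequence *)

Section BernoulliConvolution.
Variable R : numFieldType.

Lemma deriv_bernoulli_gf n :
  (bernoulli_gf R n)^`() = if n is m.+1 then bernoulli_gf R m else 0.
Proof.
apply: deriv_fps_mul_exp; apply: deriv_fps_inv => [|i].
  by case: (bernoulli_denom0 R).
by rewrite /fps_divt /fps_sub /fps_exp expr1n subr0 derivZ -polyC1 derivC scaler0.
Qed.

Lemma deriv_bernoulli n : (bernoulli R n)^`() = n%:R *: bernoulli R n.-1.
Proof.
rewrite /bernoulli derivZ deriv_bernoulli_gf; case: n => [|n].
  by rewrite scaler0 scale0r.
by rewrite scalerA -natrM.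
Qed.

Definition bernoulli_conv n : {poly R} :=
  \sum_(0 <= k < n.+1) bernoulli R k * bernoulli R (n - k)%N.

Lemma deriv_bernoulli_conv n :
  (bernoulli_conv n)^`() =
  if n is m.+1 then m.+2%:R *: bernoulli_conv m else 0.
Proof.
rewrite /bernoulli_conv raddf_sum /=.
under eq_bigr => k _ do rewrite derivM !deriv_bernoulli.
case: n => [|n]; first by rewrite big_nat1 !scale0r mul0r mulr0 addr0.
(* The first term of one half and the last term of the other have weight 0. Without them both halves
   run over the same products, with weights [i.+1] and [(n - i).+1] adding up to [n.+2]. *)
rewrite big_split /= big_nat_recl // scale0r mul0r add0r.
rewrite [X in _ + X = _]big_nat_recr //= subnn scale0r mulr0 addr0 /=.
rewrite -big_split scaler_sumr; apply: eq_big_nat => i /= le_in.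
rewrite subSS (subSn (le_in : i <= n)%N) /=.
rewrite -scalerAl -(scalerAr (n - i).+1%:R) -scalerDl -natrD.
by rewrite addSnnS !addnS subnKC.
Qed.

(* the normalization making [S_n / (n+1)!] an Appell sequence *)
Definition bernoulli_conv_gf : fps {poly R} :=
  fun n => (n.+1`!%:R : R)^-1 *: bernoulli_conv n.

Lemma bernoulli_convE n :
  bernoulli_conv n = n.+1`!%:R *: bernoulli_conv_gf n.
Proof. by rewrite scalerA mulfV ?scale1r // natf_fact_neq0. Qed.

Lemma bernoulli_conv_horner n a :
  (bernoulli_conv n).[a] = n.+1`!%:R * (bernoulli_conv_gf n).[a].
Proof. by rewrite [in LHS]bernoulli_convE hornerZ. Qed.

Lemma deriv_bernoulli_conv_gf n :
  (bernoulli_conv_gf n)^`() = if n is m.+1 then bernoulli_conv_gf m else 0.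
Proof.
rewrite /bernoulli_conv_gf derivZ deriv_bernoulli_conv.
case: n => [|n]; first by rewrite scaler0.
by rewrite scalerA factS natrM invfM mulrAC mulVf ?mul1r // pnatr_eq0.
Qed.

End BernoulliConvolution.

(** * Expansion of the factor (e^t + 1)^r against the Euler generating function *)

Section EulerPolynomials.
Variable R : numFieldType.

(** One factor 2 / (e^t + 1) cancels against e^t + 1, leaving 2. *)
Lemma euler_gfS r :
  fps_mul (euler_gf R r.+1) (fps_add (fps_exp 1) (fps_const 1)) =1
  fun n => 2 * euler_gf R r n.
Proof.
move=> n; rewrite fps_mulC /euler_gf /fps_pow iterS.
set G := fps_add _ _; set K := fps_mul (fps_const 2) _; set P := iter _ _ _.
have GK : fps_mul G K =1 fps_const 2.
  move=> i; rewrite fps_mulC -fps_mulA.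
  rewrite (eq_fps_mul (frefl _) (fps_mulVf (euler_denom0 R))).
  by rewrite fps_mul_const mulr1.
rewrite -(eq_fps_mul (frefl G) (fps_mulA _ K P (fps_exp 'X))) fps_mulA.
by rewrite (eq_fps_mul GK (frefl _)) fps_mulC fps_mul_const mulrC.
Qed.

Lemma fps_exp_0 : fps_exp 0 =1 fps_const (1 : {poly R}).
Proof. by case=> [|n]; rewrite ?fps_exp0 // /fps_exp expr0n scaler0. Qed.

Lemma fps_exp_add1 (f : fps {poly R}) p n :
  fps_mul f (fps_exp p) n + fps_mul f (fps_exp (p + 1)) n =
  fps_mul (fps_mul f (fps_exp p)) (fps_add (fps_exp 1) (fps_const 1)) n.
Proof.
rewrite fps_mulDr fps_mul_const mulr1 addrC; congr (_ + _).
by rewrite -fps_mulA; apply: eq_fps_mul => // i; apply: fps_expD.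
Qed.

(** Induction on [r]: Pascal's rule pairs e^(jt) with e^((j+1)t), each pair yields a factor e^t + 1,
    and this factor turns order [r.+1] into twice order [r]. *)
Lemma euler_gf_binomial (c : fps {poly R}) r n :
  \sum_(0 <= j < r.+1)
    fps_mul (euler_gf R r) (fps_mul c (fps_exp j%:R)) n *+ 'C(r, j) =
  2 ^+ r * fps_mul c (fps_exp 'X) n.
Proof.
elim: r => [|r IHr].
  rewrite big_nat1 mul1r mulr1n fps_mulC; apply: eq_fps_mul => i.
    by rewrite (eq_fps_mul (frefl c) fps_exp_0) fps_mul_const mulr1.
  by rewrite /euler_gf fps_mulC fps_mul_const mulr1.
rewrite sum_binS exprS -mulrA -IHr mulr_sumr; apply: eq_bigr => j _.
rewrite mulrnAr -fps_mulDr; congr (_ *+ _).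
set f := fps_mul c (fps_exp j%:R); pose G := fps_add (fps_exp (1 : {poly R})) (fps_const 1).
have fG : fps_add f (fps_mul c (fps_exp j.+1%:R)) =1 fps_mul G f.
  by move=> i; rewrite fps_mulC -fps_exp_add1 natr1.
rewrite (eq_fps_mul (frefl _) fG) fps_mulA (eq_fps_mul (euler_gfS r) (frefl f)).
by rewrite mulr_sumr; apply: eq_bigr => i _; rewrite mulrA.
Qed.

End EulerPolynomials.

Theorem theorem5 (R : numFieldType) (n r : nat) :
  \sum_(0 <= k < n.+1) bernoulli R k * bernoulli R (n - k)%N =
  (2 ^+ r : R)^-1 *:
    \sum_(0 <= k < n.+1) \sum_(k <= l < n.+1) \sum_(0 <= j < r.+1)
      (('C(r, j)%:R * 'C(n.+1, k)%:R
        * (bernoulli R (l - k)%N).[j%:R] * (bernoulli R (n - l)%N).[j%:R])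
       *: euler R r k).
Proof.
set c : fps {poly R} := fun i => (bernoulli_conv_gf R i).[0]%:P.
have gfE : bernoulli_conv_gf R =1 fps_mul c (fps_exp 'X).
  exact: appell_gf (deriv_bernoulli_conv_gf R).
(* For fixed [k] and [j] the sum over [l] is the convolution of index [n - k] at x = j, that is
   [(n - k).+1!] times a coefficient of c(t) e^(jt). *)
have inner k j : (k <= n)%N ->
    \sum_(k <= l < n.+1)
      (('C(r, j)%:R * 'C(n.+1, k)%:R
        * (bernoulli R (l - k)%N).[j%:R] * (bernoulli R (n - l)%N).[j%:R])
       *: euler R r k) =
    n.+1`!%:R *:
      (euler_gf R r k * fps_mul c (fps_exp j%:R) (n - k)%N *+ 'C(r, j)).
  move=> le_kn; rewrite -scaler_suml -{1}(add0n k) big_addn subSn //.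
  under eq_bigr => l _ do rewrite addnK addnC subnDA -mulrA -hornerM.
  rewrite -mulr_sumr -horner_sum -/(bernoulli_conv R (n - k)).
  rewrite bernoulli_conv_horner.
  rewrite -polyC_natr -(appell_horner _ _ _ _ _ gfE) [_ * _%:P]mulrC mul_polyC.
  rewrite /euler scalerA -scaler_nat !scalerA; congr (_ *: _).
  (* The normalizations of the Euler polynomial and of the convolution combine with the binomial
     coefficient into a factor independent of [k]. *)
  have -> : n.+1`!%:R = 'C(n.+1, k)%:R * (k`!%:R * (n - k).+1`!%:R) :> R.
    by rewrite -!natrM -subSn // bin_fact // leqW.
  by ring.
transitivity (n.+1`!%:R *: ((2 ^+ r : R)^-1 *: (2 ^+ r * fps_mul c (fps_exp 'X) n))).
  rewrite -[LHS]/(bernoulli_conv R n) bernoulli_convE gfE; congr (_ *: _).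
  have -> : 2 ^+ r = (2 ^+ r)%:P :> {poly R} by rewrite rmorphXn rmorph_nat.
  rewrite mul_polyC scalerA mulVf ?scale1r //.
  by rewrite expf_neq0 // pnatr_eq0.
rewrite -euler_gf_binomial scalerA mulrC -scalerA; congr (_ *: _).
(* The sum over [l] goes innermost so that [inner] applies; then [j] goes outermost, leaving a
   Cauchy product over [k]. *)
under [RHS]eq_bigr => k _ do rewrite exchange_big /=.
under [RHS]eq_big_nat => k le_kn do under eq_bigr => j _ do rewrite inner //.
rewrite exchange_big scaler_sumr /=; apply: eq_bigr => j _.
rewrite -scaler_sumr; congr (_ *: _).
by rewrite /fps_mul -sumrMnl big_mkord.
Qed.
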